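(* Let $\alpha\in\mathbb{R}$, let $\mathbf{F}^{\alpha}\in\mathbb{C}^{N\times N}$ be the $\alpha$-th graph fractional Fourier transform matrix of an undirected weighted graph $\mathcal{G}$ with $N$ vertices, and let $\bm{f},\bm{g}\in\mathbb{R}^N$ be filters such that, with $\hat{\bm{g}}=\mathbf{F}^{\alpha}\bm{g}$, one has $0\le f_i\le 1$ and $0\le \hat{g}_i\le 1$ for all $i$, and $\|\bm{f}\|_\infty=\|\hat{\bm{g}}\|_\infty=1$. Put $\mathbf{D}_f=\mathrm{diag}(\bm{f})$, $\mathbf{B}^{\alpha}_g=\mathbf{F}^{-\alpha}\,\mathrm{diag}(\hat{\bm{g}})\,\mathbf{F}^{\alpha}$, and let $\sigma_1$ be the largest eigenvalue of $\mathbf{S}^{\alpha}_{f,g}=(\mathbf{B}^{\alpha}_g)^{1/2}\mathbf{D}_f(\mathbf{B}^{\alpha}_g)^{1/2}$. Let $\bm{x}\in\mathbb{C}^N$ satisfy $\|\bm{x}\|_2=1$, and define $\zeta_f(\bm{x})=\|\mathbf{D}_f\bm{x}\|_2^2$ and $\eta^{\alpha}_g(\bm{x})=\|\mathbf{B}^{\alpha}_g\bm{x}\|_2^2$. Assume $\sigma_1<1$ and $\sigma_1\le\zeta_f(\bm{x})\,\eta^{\alpha}_g(\bm{x})$. Then $$\arccos\sqrt{\zeta_f(\bm{x})}+\arccos\sqrt{\eta^{\alpha}_g(\bm{x})}\ \ge\ \arccos\sqrt{\sigma_1}.$$ Equivalently, $\eta^{\alpha}_g(\bm{x})$ is upper bounded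 by $$\eta^{\alpha}_g(\bm{x})\ \le\ \left(\sqrt{\zeta_f(\bm{x})\,\sigma_1}+\sqrt{(1-\zeta_f(\bm{x}))(1-\sigma_1)}\right)^2.$$
   Context: Graph: $\mathcal{G}$ is an undirected graph with vertices $v_1,\dots,v_N$ and symmetric entrywise nonnegative weighted adjacency matrix $\mathbf{W}\in\mathbb{R}^{N\times N}$; $\mathbf{K}=\mathrm{diag}(k_1,\dots,k_N)$ with $k_i=\sum_j w_{ij}$ (assumed positive so that $\mathbf{K}^{-1/2}$ exists), and the normalized Laplacian is $\bm{\mathcal{L}}=\mathbf{K}^{-1/2}(\mathbf{K}-\mathbf{W})\mathbf{K}^{-1/2}=\mathbf{U}\bm{\Xi}\mathbf{U}^{\mathrm{H}}$, with $\bm{\Xi}=\mathrm{diag}(\xi_1,\dots,\xi_N)$, $0=\xi_1\le\cdots\le\xi_N$, and $\mathbf{U}$ orthogonal. Graph fractional Fourier transform (GFRFT): write $\mathbf{U}^{\mathrm{H}}=\mathbf{Q}\mathbf{\Lambda}\mathbf{Q}^{\mathrm{H}}$ with $\mathbf{Q}$ unitary and $\mathbf{\Lambda}$ diagonal (its entries have modulus $1$, since $\mathbf{U}$ is orthogonal). For $\alpha\in\mathbb{R}$, $\mathbf{F}^{\alpha}=\mathbf{Q}\mathbf{\Lambda}^{\alpha}\mathbf{Q}^{\mathrm{H}}$ and $\mathbf{F}^{-\alpha}=\mathbf{Q}\mathbf{\Lambda}^{-\alpha}\mathbf{Q}^{\mathrm{H}}$, where $\mathbf{\Lambda}^{\alpha}$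 raises each diagonal entry to the power $\alpha$ (for a diagonal entry $e^{\mathrm{i}\theta}$ with fixed argument $\theta$, e.g. the principal one, its power is $e^{\mathrm{i}\alpha\theta}$). The GFRFT of $\bm{x}\in\mathbb{C}^N$ is $\hat{\bm{x}}=\mathbf{F}^{\alpha}\bm{x}$. $(\mathbf{B}^{\alpha}_g)^{1/2}=\mathbf{F}^{-\alpha}\,\mathrm{diag}(\hat{\bm{g}})^{1/2}\,\mathbf{F}^{\alpha}$ is the Hermitian positive semidefinite square root of $\mathbf{B}^{\alpha}_g$, where $\mathrm{diag}(\hat{\bm{g}})^{1/2}$ has diagonal entries $\sqrt{\hat{g}_i}$. The matrix $\mathbf{S}^{\alpha}_{f,g}$ is Hermitian positive semidefinite with eigenvalues in $[0,1]$. In this statement $\zeta_f$ and $\eta^{\alpha}_g$ are the squared norms defined in the claim (not the quadratic forms $\bm{x}^{\mathrm{H}}\mathbf{D}_f\bm{x}$, $\bm{x}^{\mathrm{H}}\mathbf{B}^{\alpha}_g\bm{x}$). *)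

(* Defs.v *)
From HB Require Import structures.
From mathcomp Require Import all_boot all_order all_algebra.
From mathcomp Require Import spectral sesquilinear complex.
From mathcomp Require Import all_classical all_reals all_analysis.

Set Implicit Arguments.
Unset Strict Implicit.
Unset Printing Implicit Defensive.

Import Order.TTheory GRing.Theory Num.Theory.

Local Open Scope ring_scope.
Local Open Scope complex_scope.
Local Open Scope sesquilinear_scope.

Section Graph.
Variables (R : realType) (N : nat).
Implicit Types (W U : 'M[R]_N) (xi : 'rV[R]_N).

(* Self-loops are not excluded. *)
Definition undirected_weights W : Prop :=
  W^T = W /\ (forall i j, 0 <= W i j).

Definition degree W (i : 'I_N) : R := \sum_j W i j.

Definition normalized_laplacian W : 'M[R]_N :=
  let Kinvsqrt := diag_mx (\row_i (Num.sqrt (degree W i))^-1) in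
  Kinvsqrt *m (diag_mx (\row_i degree W i) - W) *m Kinvsqrt.

Definition laplacian_eigendecomposition W U xi : Prop :=
  [/\ U *m U^T = 1%:M,
      normalized_laplacian W = U *m diag_mx xi *m U^T,
      (forall i : 'I_N, nat_of_ord i = 0%N -> xi 0 i = 0)
    & (forall i j : 'I_N, (i <= j)%N -> xi 0 i <= xi 0 j)].

End Graph.

Section ComplexVectors.
Variables (R : realType) (N : nat).

Definition to_complex (m n : nat) (A : 'M[R]_(m, n)) : 'M[R[i]]_(m, n) :=
  map_mx (real_complex R) A.

Definition expi (t : R) : R[i] := cos t +i* sin t.

Definition diag_cV (v : 'cV[R[i]]_N) : 'M[R[i]]_N := diag_mx v^T.

Definition l2norm (v : 'cV[R[i]]_N) : R :=
  Num.sqrt (\sum_i ComplexField.Normc.normc (v i 0) ^+ 2).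

(* [a <= b] in R[i] means that [b - a] is a nonnegative real, so that the second
   clause also says that all the eigenvalues of [A] are real. *)
Definition largest_eigenvalue (A : 'M[R[i]]_N) (s : R) : Prop :=
  eigenvalue A s%:C /\ (forall a : R[i], eigenvalue A a -> a <= s%:C).

End ComplexVectors.

Section GFRFT.
Variables (R : realType) (N : nat).
Implicit Types (U : 'M[R]_N) (Q : 'M[R[i]]_N) (Lam : 'rV[R[i]]_N).
Implicit Types (theta : 'rV[R]_N) (alpha : R) (f g : 'cV[R]_N).
Implicit Types (x : 'cV[R[i]]_N).

(* U is real, so U^H is its transpose. *)
Definition gft_eigendecomposition U Q Lam : Prop :=
  Q \is unitarymx /\ to_complex U^T = Q *m diag_mx Lam *m Q^t*.

(* A choice of an argument for each diagonal entry, not necessarily the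
   principal one (equal entries may even be given different arguments). *)
Definition arguments_of Lam theta : Prop :=
  forall i, Lam 0 i = expi (theta 0 i).

(* Q Lam^alpha Q^H, where e^(i t) to the power alpha is e^(i alpha t); the
   matrix F^(-alpha) is [gfrft Q theta (- alpha)]. *)
Definition gfrft Q theta alpha : 'M[R[i]]_N :=
  Q *m diag_mx (\row_i expi (alpha * theta 0 i)) *m Q^t*.

Definition gfrft_hat Q theta alpha g : 'cV[R[i]]_N :=
  gfrft Q theta alpha *m to_complex g.

Definition Dmx f : 'M[R[i]]_N := diag_cV (to_complex f).

Definition Bmx Q theta alpha g : 'M[R[i]]_N :=
  gfrft Q theta (- alpha) *m diag_cV (gfrft_hat Q theta alpha g)
    *m gfrft Q theta alpha.

Definition Bmx_sqrt Q theta alpha g : 'M[R[i]]_N :=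
  gfrft Q theta (- alpha)
    *m diag_cV (map_mx sqrtC (gfrft_hat Q theta alpha g))
    *m gfrft Q theta alpha.

Definition Smx Q theta alpha f g : 'M[R[i]]_N :=
  Bmx_sqrt Q theta alpha g *m Dmx f *m Bmx_sqrt Q theta alpha g.

Definition zeta_f f x : R := l2norm (Dmx f *m x) ^+ 2.

Definition eta_g Q theta alpha g x : R :=
  l2norm (Bmx Q theta alpha g *m x) ^+ 2.

End GFRFT.

(* Main.v *)
(* Write D, B for D_f, B_g and p = <x,Dx>, q = <x,Bx>.  Since 0 <= D, B <= 1,
   one has zeta <= p <= 1 and eta <= q <= 1.  Cauchy-Schwarz applied to Dx - px
   and Bx - qx gives |<Dx,Bx> - pq|^2 <= pq(1-p)(1-q), while Cauchy-Schwarz applied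
   to D^(1/2) x and D^(1/2) B^(1/2) (B^(1/2) x), with the Rayleigh bound for S,
   gives |<Dx,Bx>|^2 <= sigma_1 pq.  Hence
     sqrt p sqrt q - sqrt (1-p) sqrt (1-q) <= sqrt sigma_1,
   an inequality whose left-hand side only decreases when p, q are replaced by
   zeta, eta; it then reads
     cos (acos sqrt zeta + acos sqrt eta) <= cos (acos sqrt sigma_1).  *)
Require Import Defs.
From HB Require Import structures.
From mathcomp Require Import all_boot all_order all_algebra.
From mathcomp Require Import spectral sesquilinear complex.
From mathcomp Require Import all_classical all_reals all_analysis.
From mathcomp Require Import ring.

Set Implicit Arguments.
Unset Strict Implicit.
Unset Printing Implicit Defensive.

Import Order.TTheory GRing.Theory Num.Theory.

Local Open Scope ring_scope.

(** * Hermitian products and quadratic forms of complex matrices *)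

Section Hermitian.
Local Open Scope sesquilinear_scope.
Variables (C : numClosedFieldType) (n : nat).
Implicit Types (A : 'M[C]_n) (u v x : 'cV[C]_n) (h : 'rV[C]_n).

Definition cdot u v : C := (u^t* *m v) 0 0.

Lemma cdotE u v : cdot u v = \sum_i (u i 0)^* * v i 0.
Proof. by rewrite /cdot mxE; apply: eq_bigr => i _; rewrite !mxE. Qed.

Lemma cdot_self u : cdot u u = \sum_i `|u i 0| ^+ 2.
Proof. by rewrite cdotE; apply: eq_bigr => i _; rewrite normCKC. Qed.

Lemma cdot_ge0 u : 0 <= cdot u u.
Proof. by rewrite cdot_self sumr_ge0 // => i _; rewrite exprn_ge0. Qed.

Lemma cdotC u v : cdot u v = (cdot v u)^*.
Proof.
rewrite !cdotE rmorph_sum; apply: eq_bigr => i _.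
by rewrite rmorphM /= conjCK mulrC.
Qed.

Lemma cdot_mull A u v : cdot (A *m u) v = cdot u (A^t* *m v).
Proof. by rewrite /cdot trmx_mul map_mxM mulmxA. Qed.

Lemma cdotBr u v x : cdot u (v - x) = cdot u v - cdot u x.
Proof. by rewrite /cdot mulmxBr !mxE. Qed.

Lemma cdotZr u v (a : C) : cdot u (a *: v) = a * cdot u v.
Proof. by rewrite /cdot -scalemxAr mxE. Qed.

Lemma cdotBl u v x : cdot (u - v) x = cdot u x - cdot v x.
Proof. by rewrite cdotC cdotBr rmorphB /= -!cdotC. Qed.

Lemma cdotZl u v (a : C) : cdot (a *: u) v = a^* * cdot u v.
Proof. by rewrite cdotC cdotZr rmorphM /= -cdotC. Qed.

Lemma cdot_CauchySchwarz u v :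
  `|cdot u v| ^+ 2 <= cdot u u * cdot v v.
Proof.
(* [dotmx] takes row vectors and conjugates its second argument, whence the transposes and the
   swap. *)
have cdot_dotmx w z : cdot w z = dotmx z^T w^T.
  rewrite dotmxE cdotE mxE; apply: eq_bigr => i _.
  by rewrite !mxE mulrC.
by rewrite !cdot_dotmx mulrC; exact: CauchySchwarz.
Qed.

Lemma cdot_diag h v : cdot v (diag_mx h *m v) = \sum_i h 0 i * `|v i 0| ^+ 2.
Proof.
rewrite cdotE; apply: eq_bigr => i _.
by rewrite mul_diag_mx mxE mulrCA normCKC.
Qed.

(** In an orthonormal eigenbasis the form is a sum of squared moduli weighted by the eigenvalues. *)
Lemma rayleigh_le A (s : C) v : A^t* = A ->
  (forall a, eigenvalue A a -> a <= s) -> cdot v (A *m v) <= s * cdot v v.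
Proof.
move=> Aherm As.
have /orthomx_spectralP : A \is normalmx by apply/normalmxP; rewrite Aherm.
set P := spectralmx A; set d := spectral_diag A => Adiag.
have Pu : P \in unitmx := spectral_unit A.
have PtP : P^t* *m P = 1%:M.
  by rewrite -(invmx_unitary (spectral_unitarymx A)) mulVmx.
have Ed : A = P^t* *m diag_mx d *m P.
  by rewrite -(invmx_unitary (spectral_unitarymx A)).
(* [eigenvalue] refers to row vectors, so row [i] of [P] is an eigenvector for [d 0 i], nonzero
   because [P] is invertible. *)
have ds i : d 0 i <= s.
  apply: As; apply/eigenvalueP; exists (row i P).
    rewrite -row_mul {1}Adiag !mulmxA mulmxV // mul1mx mul_diag_mx.
    by apply/rowP => j; rewrite !mxE.
  apply/eqP => /(congr1 (mulmxr (invmx P))) /=.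
  rewrite -row_mul mulmxV // mul0mx => /rowP /(_ i).
  by rewrite !mxE eqxx => /eqP; rewrite oner_eq0.
have -> : cdot v (A *m v) = cdot (P *m v) (diag_mx d *m (P *m v)).
  by rewrite cdot_mull Ed !mulmxA.
have -> : cdot v v = cdot (P *m v) (P *m v).
  by rewrite cdot_mull mulmxA PtP mul1mx.
rewrite cdot_diag cdot_self mulr_sumr ler_sum // => i _.
by rewrite ler_wpM2r // exprn_ge0.
Qed.

(** In the coordinates [A *m v], which preserve norms, the three quantities are sums of squared
    moduli weighted by the squares of the entries of [h], by these entries and by 1. *)
Lemma unitary_diag_contraction A h v :
  A^t* *m A = 1%:M -> A *m A^t* = 1%:M ->
  (forall i, 0 <= h 0 i <= 1) ->
  let B := A^t* *m diag_mx h *m A in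
  cdot (B *m v) (B *m v) <= cdot v (B *m v) <= cdot v v.
Proof.
move=> AtA AAt h01 /=.
have isom w : cdot (A *m w) (A *m w) = cdot w w.
  by rewrite cdot_mull mulmxA AtA mul1mx.
have isom' w : cdot (A^t* *m w) (A^t* *m w) = cdot w w.
  by rewrite cdot_mull trmxCK mulmxA AAt mul1mx.
set w := A *m v.
have -> : A^t* *m diag_mx h *m A *m v = A^t* *m (diag_mx h *m w).
  by rewrite /w !mulmxA.
rewrite isom' -cdot_mull -(isom v) -/w cdot_diag !cdot_self.
apply/andP; split; apply: ler_sum => i _; have /andP[h0 h1] := h01 i.
  rewrite mul_diag_mx mxE normrM ger0_norm // exprMn ler_wpM2r ?exprn_ge0 //.
  by rewrite expr2 ler_piMr.
by rewrite ler_piMl ?exprn_ge0.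
Qed.

Lemma diag_adj_ge0 h : (forall i, 0 <= h 0 i) -> (diag_mx h)^t* = diag_mx h.
Proof.
move=> h0; rewrite tr_diag_mx map_diag_mx; congr diag_mx; apply/rowP => i.
by rewrite mxE; apply/CrealP/ger0_real.
Qed.

Lemma conj_diag_adj A h : (forall i, 0 <= h 0 i) ->
  (A^t* *m diag_mx h *m A)^t* = A^t* *m diag_mx h *m A.
Proof.
by move=> h0; rewrite !trmx_mul !map_mxM trmxCK diag_adj_ge0 // mulmxA.
Qed.

Lemma diag_sqrtC_sqr h :
  diag_mx (map_mx sqrtC h) *m diag_mx (map_mx sqrtC h) = diag_mx h.
Proof.
rewrite mulmx_diag; congr diag_mx; apply/rowP => i.
by rewrite !mxE -expr2 sqrtCK.
Qed.

Lemma conj_diag_sqrtC_sqr A h : A *m A^t* = 1%:M ->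
  A^t* *m diag_mx (map_mx sqrtC h) *m A *m
    (A^t* *m diag_mx (map_mx sqrtC h) *m A) = A^t* *m diag_mx h *m A.
Proof.
move=> AAt; rewrite !mulmxA -(mulmxA _ A) AAt mulmx1.
by rewrite -(mulmxA _ _ (diag_mx (map_mx _ _))) diag_sqrtC_sqr.
Qed.

Lemma diag_unitary h : (forall i, h 0 i * (h 0 i)^* = 1) ->
  diag_mx h \is unitarymx.
Proof.
move=> h1; apply/unitarymxP; rewrite tr_diag_mx map_diag_mx mulmx_diag.
by rewrite -diag_const_mx; congr diag_mx; apply/rowP => i; rewrite !mxE.
Qed.

(** [E] and [K] are meant as roots of [D_f] and [B_g]. Moving one [E] across the product pairs
    [E *m x] with [E *m K *m (K *m x)], whose squared norm is the form of [K *m (E *m E) *m K] at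
    [K *m x]. *)
Lemma cdot_sq_le (E K : 'M[C]_n) (s : C) x : E^t* = E -> K^t* = K ->
  (forall a, eigenvalue (K *m (E *m E) *m K) a -> a <= s) ->
  `|cdot (E *m E *m x) (K *m K *m x)| ^+ 2 <=
    s * (cdot x (E *m E *m x) * cdot x (K *m K *m x)).
Proof.
move=> Eh Kh Ss.
have Sh : (K *m (E *m E) *m K)^t* = K *m (E *m E) *m K.
  by rewrite !trmx_mul !map_mxM Eh Kh !mulmxA.
have -> : cdot x (E *m E *m x) = cdot (E *m x) (E *m x).
  by rewrite [RHS]cdot_mull Eh mulmxA.
have -> : cdot x (K *m K *m x) = cdot (K *m x) (K *m x).
  by rewrite [RHS]cdot_mull Kh mulmxA.
have -> : cdot (E *m E *m x) (K *m K *m x) =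
          cdot (E *m x) (E *m K *m (K *m x)).
  by rewrite -(mulmxA E E x) (cdot_mull E (E *m x)) Eh !mulmxA.
apply: (le_trans (cdot_CauchySchwarz _ _)).
rewrite mulrCA ler_wpM2l ?cdot_ge0 //.
apply: le_trans (rayleigh_le (K *m x) Sh Ss).
by rewrite (cdot_mull (E *m K)) trmx_mul map_mxM Eh Kh !mulmxA.
Qed.

(** [p *: x] and [q *: x] are the projections of [u] and [v] on the unit vector [x]; removing them
    turns [cdot u u] into [cdot u u - p ^+ 2], at most [p * (1 - p)], and likewise for [v]. *)
Lemma cdot_sub_mean_le x u v (p q : C) : cdot x x = 1 ->
  cdot x u = p -> cdot x v = q -> 0 <= p -> 0 <= q ->
  cdot u u <= p -> cdot v v <= q -> q <= 1 ->
  `|cdot u v - p * q| ^+ 2 <= (p * q) * ((1 - p) * (1 - q)).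
Proof.
move=> x1 xu xv p0 q0 up vq q1.
have pr : p^* = p by apply/CrealP/ger0_real.
have qr : q^* = q by apply/CrealP/ger0_real.
have ux : cdot u x = p by rewrite cdotC xu.
have vx : cdot v x = q by rewrite cdotC xv.
have -> : cdot u v - p * q = cdot (u - p *: x) (v - q *: x).
  rewrite !(cdotBl, cdotBr, cdotZl, cdotZr) x1 ux xv pr; ring.
apply: (le_trans (cdot_CauchySchwarz _ _)).
have -> : p * q * ((1 - p) * (1 - q)) = (p - p ^+ 2) * (q - q ^+ 2) by ring.
apply: ler_pM; rewrite ?cdot_ge0 //.
  rewrite !(cdotBl, cdotBr, cdotZl, cdotZr) x1 ux xu pr.
  rewrite (_ : _ - _ = cdot u u - p ^+ 2) ?lerD2r //; ring.
rewrite !(cdotBl, cdotBr, cdotZl, cdotZr) x1 vx xv qr.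
rewrite (_ : _ - _ = cdot v v - q ^+ 2) ?lerD2r //; ring.
Qed.

End Hermitian.

Local Open Scope complex_scope.

(** * Arccosines of square roots *)

Section RealAngles.
Variable R : realType.
Implicit Types s p q m k : R.

Lemma le_cos_0pi : {in `[0, pi] &, {mono @cos R : x y /~ y <= x}}.
Proof. by move=> x y xpi ypi; rewrite !leNgt ltr_cos. Qed.

(** [m] and [k] stand for [|<Dx,Bx>|] and [|<Dx,Bx> - pq|]. Each is at most [Num.sqrt (p * q)] times
    a term of the right-hand side, and this common factor is cancelled. *)
Lemma sqrt_mul_le s p q m k : 0 <= p <= 1 -> 0 <= q <= 1 ->
  p * q <= m + k -> m ^+ 2 <= s * (p * q) ->
  k ^+ 2 <= p * q * ((1 - p) * (1 - q)) ->
  Num.sqrt p * Num.sqrt q <= Num.sqrt s + Num.sqrt (1 - p) * Num.sqrt (1 - q).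
Proof.
move=> /andP[p0 p1] /andP[q0 q1] pqmk ms kpq.
have pq0 : 0 <= p * q by rewrite mulr_ge0.
have le_sqrt (a b : R) : a ^+ 2 <= b -> a <= Num.sqrt b.
  move=> ab; apply: (le_trans (ler_norm a)).
  by rewrite -sqrtr_sqr ler_wsqrtr.
have mle : m <= Num.sqrt (p * q) * Num.sqrt s.
  by rewrite -sqrtrM // le_sqrt // mulrC.
have kle : k <= Num.sqrt (p * q) * Num.sqrt ((1 - p) * (1 - q)).
  by rewrite -sqrtrM // le_sqrt.
rewrite -sqrtrM // -[Num.sqrt (1 - p) * _]sqrtrM ?subr_ge0 //.
(* The common factor cannot be cancelled when it vanishes, but then the left-hand side is zero. *)
have [->|pq_neq0] := eqVneq (p * q) 0.
  by rewrite sqrtr0 addr_ge0 ?sqrtr_ge0.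
have r0 : 0 < Num.sqrt (p * q) by rewrite sqrtr_gt0 lt_neqAle eq_sym pq_neq0.
rewrite -(ler_pM2l r0) -expr2 sqr_sqrtr // mulrDr.
by apply: (le_trans pqmk); exact: lerD.
Qed.

Lemma sqrt_unit_itv p : p <= 1 -> -1 <= Num.sqrt p <= 1.
Proof.
move=> p1; rewrite (le_trans _ (sqrtr_ge0 p)) ?lerN10 //=.
by rewrite -[leRHS]sqrtr1 ler_wsqrtr.
Qed.

Lemma sin_acos_sqrt p : 0 <= p <= 1 ->
  sin (acos (Num.sqrt p)) = Num.sqrt (1 - p).
Proof.
by move=> /andP[p0 p1]; rewrite sin_acos ?sqrt_unit_itv // sqr_sqrtr.
Qed.

(** Keeps the sum of two such angles in [[0, pi]], where [cos] is decreasing. *)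
Lemma acos_sqrt_le_pihalf p : p <= 1 -> acos (Num.sqrt p) <= pi / 2.
Proof.
move=> p1; have p1' := sqrt_unit_itv p1.
rewrite -le_cos_0pi ?in_itv /= ?acos_ge0 ?acos_lepi //.
  by rewrite cos_pihalf acosK ?in_itv //= sqrtr_ge0.
by rewrite divr_ge0 ?pi_ge0 //= ler_piMr ?pi_ge0 // invf_le1 ?ler1n.
Qed.

Lemma acos_sqrt_add_ge s p q : 0 <= p <= 1 -> 0 <= q <= 1 -> s <= 1 ->
  Num.sqrt p * Num.sqrt q <= Num.sqrt s + Num.sqrt (1 - p) * Num.sqrt (1 - q) ->
  acos (Num.sqrt s) <= acos (Num.sqrt p) + acos (Num.sqrt q).
Proof.
move=> p01 q01 s1 pqs.
have /andP[_ p1] := p01; have /andP[_ q1] := q01.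
have [p2 q2] := (acos_sqrt_le_pihalf p1, acos_sqrt_le_pihalf q1).
have [s' p' q'] :=
  And3 (sqrt_unit_itv s1) (sqrt_unit_itv p1) (sqrt_unit_itv q1).
rewrite -le_cos_0pi.
- rewrite cosD !acosK ?in_itv //= !sin_acos_sqrt // lerBlDr //.
- by rewrite in_itv /= acos_ge0 // acos_lepi.
- by rewrite in_itv /= addr_ge0 ?acos_ge0 //= [leRHS](splitr pi) lerD.
Qed.

(** Since [s <= p], the angle of [s] minus that of [p] lies in [[0, pi]]. There [cos] reverses the
    order, and its subtraction formula bounds [Num.sqrt q]. *)
Lemma le_of_acos_sqrt_add_ge s p q : 0 <= p <= 1 -> 0 <= q <= 1 -> s <= p ->
  acos (Num.sqrt s) <= acos (Num.sqrt p) + acos (Num.sqrt q) ->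
  q <= (Num.sqrt (p * s) + Num.sqrt ((1 - p) * (1 - s))) ^+ 2.
Proof.
move=> p01 q01 sp spq.
have /andP[p0 p1] := p01; have /andP[q0 q1] := q01.
have s1 := le_trans sp p1.
have [s' p' q'] :=
  And3 (sqrt_unit_itv s1) (sqrt_unit_itv p1) (sqrt_unit_itv q1).
(* Strict when [s < 0], where [Num.sqrt s] is [0]. *)
have s_le : s <= Num.sqrt s ^+ 2.
  have [s0|/ltW s0] := leP 0 s; first by rewrite sqr_sqrtr.
  by rewrite (le_trans s0) ?sqr_ge0.
have s_p : acos (Num.sqrt p) <= acos (Num.sqrt s).
  by rewrite -le_cos_0pi ?in_itv /= ?acos_ge0 ?acos_lepi // !acosK
    ?in_itv //= ler_wsqrtr.
have d0pi : 0 <= acos (Num.sqrt s) - acos (Num.sqrt p) <= pi.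
  by rewrite subr_ge0 s_p lerBlDr (le_trans (acos_lepi s')) // lerDl acos_ge0.
move: spq; rewrite -lerBlDl.
rewrite -[X in is_true X -> _]le_cos_0pi ?in_itv /= ?acos_ge0 ?acos_lepi //.
rewrite cosB !acosK ?in_itv //= (sin_acos_sqrt p01) (sin_acos s') => qle.
rewrite -[leLHS](sqr_sqrtr q0) lerXn2r ?nnegrE ?addr_ge0 ?sqrtr_ge0 //.
(* The sine of the angle of [s] is [Num.sqrt (1 - Num.sqrt s ^+ 2)], which [s_le] bounds by
   [Num.sqrt (1 - s)]. *)
apply: (le_trans qle); rewrite (sqrtrM _ p0) sqrtrM ?subr_ge0 //.
rewrite mulrC lerD2l mulrC ler_wpM2l ?sqrtr_ge0 // ler_wsqrtr //.
by rewrite lerD2l lerN2.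
Qed.

(** Here [z], [e] are the squared norms and [p], [q] the quadratic forms. *)
Lemma angle_bounds s z e p q m k : 0 <= z <= p -> 0 <= e <= q ->
  p <= 1 -> q <= 1 -> p * q <= m + k -> m ^+ 2 <= s * (p * q) ->
  k ^+ 2 <= p * q * ((1 - p) * (1 - q)) -> s <= 1 -> s <= z * e ->
  acos (Num.sqrt s) <= acos (Num.sqrt z) + acos (Num.sqrt e) /\
  e <= (Num.sqrt (z * s) + Num.sqrt ((1 - z) * (1 - s))) ^+ 2.
Proof.
move=> /andP[z0 zp] /andP[e0 eq] p1 q1 pqmk ms kpq s1 sze.
have z01 : 0 <= z <= 1 by rewrite z0 (le_trans zp).
have e01 : 0 <= e <= 1 by rewrite e0 (le_trans eq).
have p01 : 0 <= p <= 1 by rewrite (le_trans z0).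
have q01 : 0 <= q <= 1 by rewrite (le_trans e0).
have angle : acos (Num.sqrt s) <= acos (Num.sqrt z) + acos (Num.sqrt e).
  apply: acos_sqrt_add_ge => //.
  apply: (@le_trans _ _ (Num.sqrt p * Num.sqrt q)).
    by rewrite ler_pM ?sqrtr_ge0 // ler_wsqrtr.
  apply: (le_trans (sqrt_mul_le p01 q01 pqmk ms kpq)).
  by rewrite lerD2l ler_pM ?sqrtr_ge0 // ler_wsqrtr // lerD2l lerN2.
split=> //; apply: le_of_acos_sqrt_add_ge => //.
(* [e <= 1] turns [s <= z * e] into [s <= z]. *)
by rewrite (le_trans sze) // ler_piMr //; case/andP: e01.
Qed.

End RealAngles.

(** * Passage between [R] and [R[i]], and unitarity of the transform *)

Section ComplexMatrices.
Local Open Scope sesquilinear_scope.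
Variables (R : realType) (N : nat).

Lemma l2norm_sqr (v : 'cV[R[i]]_N) : (l2norm v ^+ 2)%:C = cdot v v.
Proof.
rewrite /l2norm sqr_sqrtr ?sumr_ge0 // => [|i _]; last by rewrite sqr_ge0.
by rewrite cdot_self rmorph_sum; apply: eq_bigr => i _; rewrite rmorphXn.
Qed.

(** Comparable complex numbers have equal imaginary parts. This brings the quadratic forms and
    moduli back to [R]. *)
Lemma ge0_complexP (c : R[i]) : 0 <= c -> exists r : R, c = r%:C.
Proof.
case: c => a b; rewrite lecE /= => /andP[/eqP -> _].
by exists a.
Qed.

Lemma conj_expi (t : R) : (expi t)^* = expi (- t).
Proof. by rewrite /expi cosN sinN. Qed.

Lemma expiD (a b : R) : expi (a + b) = expi a * expi b.
Proof.
rewrite /expi cosD sinD; apply/eqP; rewrite eq_complex /= eqxx /=.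
by apply/eqP; rewrite addrC.
Qed.

Lemma expi0 : expi 0 = 1 :> R[i].
Proof. by rewrite /expi cos0 sin0. Qed.

Variables (Q : 'M[R[i]]_N) (theta : 'rV[R]_N) (alpha : R).

(** Conjugation negates the exponent of each diagonal entry; this puts [Bmx] in the form
    [A^t* *m diag_mx h *m A]. *)
Lemma gfrft_adj : (gfrft Q theta alpha)^t* = gfrft Q theta (- alpha).
Proof.
rewrite /gfrft !trmx_mul !map_mxM trmxCK tr_diag_mx map_diag_mx mulmxA.
suff -> : map_mx Num.conj (\row_i expi (alpha * theta 0 i)) =
          \row_i expi (- alpha * theta 0 i) by [].
by apply/rowP => i; rewrite !mxE mulNr; exact: conj_expi.
Qed.

Lemma gfrft_unitary : Q \is unitarymx -> gfrft Q theta alpha \is unitarymx.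
Proof.
move=> Qu; apply: mul_unitarymx; last by rewrite trmxC_unitary.
apply: (mul_unitarymx Qu); apply: diag_unitary => i.
by rewrite mxE [X in _ * X]conj_expi -expiD subrr expi0.
Qed.

End ComplexMatrices.

Theorem lemma1 (R : realType) (N : nat)
    (W U : 'M[R]_N) (xi : 'rV[R]_N)
    (Q : 'M[R[i]]_N) (Lam : 'rV[R[i]]_N) (theta : 'rV[R]_N) (alpha : R)
    (f g : 'cV[R]_N) (sigma1 : R) (x : 'cV[R[i]]_N)
    (hW : undirected_weights W)
    (hK : forall i, 0 < degree W i)
    (hU : laplacian_eigendecomposition W U xi)
    (hQ : gft_eigendecomposition U Q Lam)
    (htheta : arguments_of Lam theta)
    (hf : forall i, 0 <= f i 0 <= 1)
    (hg : forall i, 0 <= gfrft_hat Q theta alpha g i 0 <= 1)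
    (hf1 : mx_norm f = 1)
    (hg1 : mx_norm (gfrft_hat Q theta alpha g) = 1)
    (hsigma1 : largest_eigenvalue (Smx Q theta alpha f g) sigma1)
    (hx : l2norm x = 1)
    (hlt : sigma1 < 1)
    (hle : sigma1 <= zeta_f f x * eta_g Q theta alpha g x) :
  acos (Num.sqrt (zeta_f f x)) + acos (Num.sqrt (eta_g Q theta alpha g x))
    >= acos (Num.sqrt sigma1)
  /\ eta_g Q theta alpha g x <=
       (Num.sqrt (zeta_f f x * sigma1)
        + Num.sqrt ((1 - zeta_f f x) * (1 - sigma1))) ^+ 2.
Proof.
have Au := gfrft_unitary theta alpha hQ.1.
have AAt := unitarymxP Au; have AtA := mulmx1C AAt.
have Eadj := gfrft_adj Q theta alpha.
set A := gfrft Q theta alpha in AAt AtA Eadj Au.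
set gh := gfrft_hat Q theta alpha g in hg hg1.
pose h := gh^T; have h01 i : 0 <= h 0 i <= 1 by rewrite mxE hg.
pose F := to_complex f; have F01 i : 0 <= F^T 0 i <= 1.
  by rewrite !mxE lecR (lecR _ 1) hf.
pose B := Bmx Q theta alpha g; pose K := Bmx_sqrt Q theta alpha g.
have EB : B = (A^t*)%sesqui *m diag_mx h *m A.
  by rewrite Eadj.
have EK : K = (A^t*)%sesqui *m diag_mx (map_mx sqrtC h) *m A.
  by rewrite Eadj -map_trmx.
clearbody A gh.
have KK : K *m K = B by rewrite EK EB conj_diag_sqrtC_sqr.
have Kh : (K^t* = K)%sesqui.
  rewrite EK; apply: conj_diag_adj => i.
  by rewrite mxE sqrtC_ge0; case/andP: (h01 i).
(* A Hermitian root of [Dmx f], so that [K *m (E *m E) *m K] is [Smx]. *)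
pose E := diag_mx (map_mx sqrtC F^T).
have EE : E *m E = Dmx f := diag_sqrtC_sqr _.
have Eh : (E^t* = E)%sesqui.
  apply: diag_adj_ge0 => i.
  by rewrite mxE sqrtC_ge0; case/andP: (F01 i).
have x1 : cdot x x = 1 by rewrite -l2norm_sqr hx expr1n.
have /andP[Bq qle] := unitary_diag_contraction x AtA AAt h01.
rewrite -EB in Bq qle.
(* [Dmx f] is already diagonal: the contraction lemma is used with the identity as unitary
   matrix. *)
have I1 : (1%:M^t* : 'M[R[i]]_N)%sesqui = 1%:M by rewrite trmx1 map_mx1.
have I2 : (1%:M^t* *m 1%:M)%sesqui = 1%:M :> 'M[R[i]]_N by rewrite I1 mulmx1.
have I3 : (1%:M *m 1%:M^t*)%sesqui = 1%:M :> 'M[R[i]]_N by rewrite I1 mulmx1.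
have /andP[Dp ple] := unitary_diag_contraction x I2 I3 F01.
rewrite I1 mul1mx mulmx1 -/(Dmx f) in Dp ple.
have := cdot_sq_le x Eh Kh; rewrite EE KK => /(_ sigma1%:C hsigma1.2).
have [p Ep] := ge0_complexP (le_trans (cdot_ge0 _) Dp).
have [q Eq] := ge0_complexP (le_trans (cdot_ge0 _) Bq).
have p0 : 0 <= p%:C by rewrite -Ep (le_trans (cdot_ge0 _) Dp).
have q0 : 0 <= q%:C by rewrite -Eq (le_trans (cdot_ge0 _) Bq).
rewrite Ep Eq x1 in Dp ple Bq qle *.
have := cdot_sub_mean_le x1 Ep Eq p0 q0 Dp Bq qle.
set c := cdot _ _ => cdist cle.
(* Triangle inequality for [pq = c - (c - pq)]. *)
have ctri : (p * q)%:C <= `|c| + `|c - p%:C * q%:C|.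
  rewrite rmorphM /= -[leLHS](ger0_norm (mulr_ge0 p0 q0)).
  by rewrite -[X in `|X|](subKr c) (le_trans (ler_normB _ _)).
have [m Em] := ge0_complexP (normr_ge0 c).
have [k Ek] := ge0_complexP (normr_ge0 (c - p%:C * q%:C)).
have zp : 0 <= zeta_f f x <= p by rewrite sqr_ge0 -lecR [leLHS]l2norm_sqr.
have eq : 0 <= eta_g Q theta alpha g x <= q.
  by rewrite sqr_ge0 -lecR [leLHS]l2norm_sqr.
have p1 : p <= 1 by rewrite -lecR.
have q1 : q <= 1 by rewrite -lecR.
have mle : m ^+ 2 <= sigma1 * (p * q) by rewrite -lecR rmorphXn !rmorphM /= -Em.
have kle : k ^+ 2 <= p * q * ((1 - p) * (1 - q)).
  by rewrite -lecR rmorphXn !rmorphM !rmorphB /= -Ek.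
have pqle : p * q <= m + k by rewrite -lecR rmorphD /= -Em -Ek.
exact: (angle_bounds zp eq p1 q1 pqle mle kle (ltW hlt) hle).
Qed.
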